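(* Let $X$ be a real Banach space, let $C\subseteq X$ be nonempty and convex, and let $K:C\rightrightarrows C$ be a compact and lower semicontinuous set-valued map with nonempty values in $\mathcal{D}(X)$ and such that $\operatorname{fix} K$ is closed. Assume that $f:C\rightarrow\mathbb{R}$ is continuous and quasiconvex. Then the quasioptimization problem has a solution, that is, there exists $x\in K(x)$ such that $$f(x)\le f(y),\qquad\forall y\in K(x).$$
   Context: $X$ is a real Banach space equipped with the norm topology. A function $f:C\to\mathbb{R}$ on a convex set $C$ is quasiconvex if the sublevel set $\{x\in C:f(x)\le\lambda\}$ is convex for all $\lambda\in\mathbb{R}$. For $C\subseteq X$ and $K:C\rightrightarrows C$: $K$ is lower semicontinuous if for every open set $\Omega$ the set $\{x\in C:K(x)\cap\Omega\neq\emptyset\}$ is open in $C$; $K$ is compact if $K(C)=\bigcup_{x\in C}K(x)$ is contained in a compact subset of $C$; $\operatorname{fix}K=\{x\in C:x\in K(x)\}$ is the set of fixed points of $K$. The class $\mathcal{D}(X)$: for a convex set $D\subseteq X$, a convex set $S\subseteq D$ is a face of $D$ if $x_1,x_2\in D$, $t\in(0,1)$ and $tx_1+(1-t)x_2\in S$ imply $x_1,x_2\in S$. Let $\mathcal{F}_D$ be the (possibly empty) collection of all proper closed faces of the closure $\operatorname{cl}D$ (proper meaning different from $\operatorname{cl}D$). The set of inside points of $D$ is $I(D)=D\setminus\bigcup_{S\in\mathcal{F}_D}S$. Then $$\mathcal{D}(X)=\{D\subseteq X: D\text{ is convex and } I(\operatorname{cl}D)\subseteq D\}.$$ *)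

(* Defs.v *)
From HB Require Import structures.
From mathcomp Require Import all_boot all_order all_algebra.
From mathcomp Require Import all_classical all_reals all_analysis.

Set Implicit Arguments.
Unset Strict Implicit.
Unset Printing Implicit Defensive.

Import Order.TTheory GRing.Theory Num.Theory.
Import numFieldNormedType.Exports.

Local Open Scope classical_set_scope.
Local Open Scope ring_scope.

(* A map defined on a subset C of X is given by a function on all of X, of
   which only the values at points of C are ever used. *)

Section QuasiOptimization.
Context {R : realType} {X : normedModType R}.
Implicit Types (C D S : set X) (K : X -> set X) (f : X -> R).

Definition quasiconvex C f : Prop :=
  forall lambda : R, @convex_set R X [set x | C x /\ f x <= lambda].

Definition set_valued_map C K : Prop := forall x, C x -> K x `<=` C.

(* Openness in C is openness in [subspace C], whose points outside C are
   isolated; on subsets of C this is the relative topology. *)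
Definition lsc_map C K : Prop :=
  forall Omega : set X, open Omega ->
    open ([set x | C x /\ K x `&` Omega !=set0] : set (subspace C)).

Definition compact_map C K : Prop :=
  exists Q : set X, [/\ compact Q, Q `<=` C & \bigcup_(x in C) K x `<=` Q].

Definition fixed_points C K : set X := [set x | C x /\ K x x].

(* The empty set is a face; this does not affect [inside_points]. *)
Definition face D S : Prop :=
  [/\ S `<=` D, @convex_set R X S &
      forall (x1 x2 : X) (t : R), D x1 -> D x2 -> 0 < t -> t < 1 ->
        S (t *: x1 + (1 - t) *: x2) -> S x1 /\ S x2].

Definition proper_closed_faces D : set (set X) :=
  [set S | [/\ face (closure D) S, closed S & S <> closure D]].

Definition inside_points D : set X :=
  D `\` \bigcup_(S in proper_closed_faces D) S.

Definition classD : set (set X) :=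
  [set D | @convex_set R X D /\ inside_points (closure D) `<=` D].

End QuasiOptimization.

(* Main.v *)
(* If no solution exists, compactness of the fixed-point set yields a uniform
   [eps] such that every fixed point x has some y in K x with f y < f x - eps.
   Cut K x down to those y when x is a fixed point, and keep K x otherwise:
   since fix K is closed, the resulting map G is still lower semicontinuous,
   with nonempty convex values.  Michael's construction gives a dense sequence
   of continuous selections of cl G; their weighted average g has, at each x, a
   value lying in no proper closed face of cl (K x), hence g x is in K x because
   K x belongs to D(X).  Schauder's theorem gives x = g x, a fixed point with
   f x = f (g x) <= f x - eps, a contradiction.
   Brouwer's theorem on the simplex, behind Schauder's, is obtained from
   Scarf's lemma on finitely many linear orders applied to a fine grid. *)

Require Import Defs.
From HB Require Import structures.
From mathcomp Require Import all_boot all_order all_algebra.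
From mathcomp Require Import all_classical all_reals all_analysis.
From mathcomp Require Import zify ring lra.

Set Implicit Arguments.
Unset Strict Implicit.
Unset Printing Implicit Defensive.

Import Order.TTheory GRing.Theory Num.Theory.
Import numFieldNormedType.Exports.

Local Open Scope classical_set_scope.
Local Open Scope ring_scope.

(** * Scarf's lemma *)

(** The uniform [eps] is what survives the passage to closures: a continuous selection only reaches
    the closure of the values of G, where the bare inequality [f z < f x] would weaken to one
    without contradiction. A second obstacle is that G is averaged while membership in D(X) concerns
    faces of the closure of K x. A closed face through g x is first shown to contain G x, and the
    openness of the condition cutting G x out of K x then forces it to contain K x. In Scarf's
    lemma, dominance among linear orders takes the place of the cells of a triangulation. *)

Section Scarf.
Import mathcomp.boot.fintype mathcomp.boot.finset.
Local Open Scope nat_scope.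
Local Open Scope set_scope.

Variables (I Z : finType) (u : I -> Z -> nat) (s : I -> Z) (c : Z -> I).
Hypothesis u_inj : forall i, injective (u i).
Hypothesis slack_low : forall i z, z != s i -> u i (s i) < u i z.
Hypothesis slack_high :
  forall i j z, j != i -> z \notin codom s -> u i z < u i (s j).
Hypothesis color_slack : cancel s c.

(** Scarf's dominance, in complement form: no [y] lies strictly above the minimum of a nonempty [W]
    in every order at once. *)
Definition dominant (W : {set Z}) : bool :=
  [forall y, [exists i, [forall b in W, u i y <= u i b]]].

Lemma dominantP (W : {set Z}) :
  reflect (forall y, exists i, forall b, b \in W -> u i y <= u i b) (dominant W).
Proof.
apply: (iffP forallP) => h y.
  have /existsP[i /forall_inP hi] := h y; by exists i.
by have [i hi] := h y; apply/existsP; exists i; apply/forall_inP.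
Qed.

Lemma dominant_sub (W V : {set Z}) : W \subset V -> dominant V -> dominant W.
Proof.
move=> /subsetP WV /dominantP domV; apply/dominantP => y.
by have [i hi] := domV y; exists i => b /WV /hi.
Qed.

Lemma argmin_exists (W : {set Z}) i : W != set0 ->
  exists2 m, m \in W & forall b, b \in W -> u i m <= u i b.
Proof. by case/set0Pn => w wW; case: (arg_minnP (u i) wW) => m mW hm; exists m. Qed.

(** When [m k] is the [k]-minimum of a set, adding one of these points leaves its minima in all
    orders but [i] unchanged. *)
Definition above (m : I -> Z) (i : I) : {set Z} :=
  [set y | [forall k, (k != i) ==> (u k (m k) < u k y)]].

Lemma aboveP (m : I -> Z) i y :
  reflect (forall k, k != i -> u k (m k) < u k y) (y \in above m i).
Proof.
rewrite inE; apply: (iffP forallP) => h k; first by apply/implyP.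
by apply/implyP/h.
Qed.

(** * Enlarging a dominant set that has one element fewer than there are orders *)

Section Door.
Variables (W : {set Z}) (m : I -> Z) (i j : I).
Hypothesis domW : dominant W.
Hypothesis cardW : #|W|.+1 = #|I|.
Hypothesis mW : forall k, m k \in W.
Hypothesis m_min : forall k b, b \in W -> u k (m k) <= u k b.
Hypothesis ij : i != j.
Hypothesis mij : m i = m j.

Lemma above_le_min (y b : Z) : y \in above m i -> b \in W -> u i y <= u i b.
Proof.
move=> /aboveP yM bW; have [k hk] := dominantP _ domW y.
have [<-|ki] := eqVneq k i; first exact: hk.
by have := yM k ki; rewrite ltnNge hk.
Qed.

(** In [W], [y] would be the [i]-minimum, hence also the [j]-minimum, which [above] forbids. For
    dominance, a [z] not beating some [m k] with [k != i] is handled by [k]; any other lies in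
    [above m i], where [y] is highest. *)
Lemma argmax_above (y : Z) : y \in above m i ->
  (forall z, z \in above m i -> u i z <= u i y) ->
  y \notin W /\ dominant (y |: W).
Proof.
move=> yM ymax; split.
  apply/negP => yW; have := above_le_min yM (mW i) => le1.
  have eqy : y = m i by apply: (u_inj (i := i)); apply/eqP; rewrite eqn_leq le1 m_min.
  by have /aboveP/(_ j) := yM; rewrite eq_sym => /(_ ij); rewrite -mij -eqy ltnn.
apply/dominantP => z; have [/existsP[k /andP[ki zk]]|] :=
    boolP [exists k, (k != i) && (u k z <= u k (m k))].
  exists k => b; rewrite in_setU1 => /orP[/eqP->|bW]; last exact: leq_trans (m_min _ bW).
  by apply: leq_trans zk (ltnW _); have /aboveP := yM; apply.
rewrite negb_exists => /forallP hz.
have zM : z \in above m i.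
  by apply/aboveP => k ki; rewrite ltnNge; have := hz k; rewrite ki.
exists i => b; rewrite in_setU1 => /orP[/eqP->|bW]; first exact: ymax.
exact: above_le_min.
Qed.

(** The enlarged set has as many elements as there are orders, so each element is the minimum of
    exactly one order. Were the order of [y] neither [i] nor [j], these two would belong to
    different elements of [W], against [m i = m j]. *)
Lemma neighbour_above (y : Z) : y \notin W -> dominant (y |: W) ->
  exists2 k, (k == i) || (k == j) &
    y \in above m k /\ forall z, z \in above m k -> u k z <= u k y.
Proof.
move=> yW /dominantP domV; set V := y |: W in domV.
have [phi phiP] := choice domV.
have phi_inj : {in V &, injective phi}.
  move=> a b aV bV e; apply: (u_inj (i := phi a)); apply/eqP.
  by rewrite eqn_leq phiP // e phiP.
have imphi : phi @: V = setT.
  apply/eqP; rewrite eqEcard subsetT /= cardsT card_in_imset //.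
  by rewrite cardsU1 yW add1n cardW.
have m_phi k : k != phi y -> exists2 b, b \in W & k = phi b /\ b = m k.
  move=> ky; have : k \in phi @: V by rewrite imphi inE.
  case/imsetP => b; rewrite in_setU1 => /orP[/eqP->|bW] e; first by rewrite e eqxx in ky.
  exists b => //; split => //; apply: (u_inj (i := k)); apply/eqP.
  by rewrite eqn_leq m_min // e phiP // in_setU1 mW orbT.
exists (phi y).
  rewrite eq_sym [phi y == j]eq_sym; apply: contraT; rewrite negb_or => /andP[/m_phi].
  case=> b _ [ei eb] /m_phi[b' _ [ej eb']].
  by move: ij; rewrite ei ej eb eb' mij eqxx.
split.
  apply/aboveP => k /m_phi[b bW [ek eb]]; rewrite -eb ltn_neqAle.
  have -> : u k b <= u k y by rewrite ek phiP ?setU11.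
  rewrite andbT; apply/negP => /eqP/u_inj e.
  by rewrite -e bW in yW.
move=> z /aboveP zM; have [k hk] := domV z.
have [<-|ky] := eqVneq k (phi y); first by apply: hk; rewrite setU11.
by have := zM k ky; rewrite ltnNge hk // in_setU1 mW orbT.
Qed.

End Door.

(** * Doors, cells and the parity count *)

Variable i0 : I.

Definition door : {set {set Z}} :=
  [set W | [&& dominant W, c @: W == ~: [set i0] & #|W|.+1 == #|I|]].

Definition cell : {set {set Z}} := [set V | dominant V && (#|V| == #|I|)].

Definition door0 : {set Z} := s @: ~: [set i0].

Lemma color_door0 : c @: door0 = ~: [set i0].
Proof. by rewrite /door0 -imset_comp (eq_imset _ (g := id)) ?imset_id // => x /=. Qed.

Lemma card_slack k : #|s @: ~: [set k]|.+1 = #|I|.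
Proof.
rewrite card_imset; last exact: can_inj color_slack.
by rewrite cardsC1 prednK //; apply/card_gt0P; exists k.
Qed.

(** In order [k] all non-slack points and [s k] itself are below [s t], so [W] holds only slacks
    other than [s k]. Counting gives all of them, and the missing colour forces [k] to be [i0]. *)
Lemma door_eq_slack (W : {set Z}) t k : W \in door -> t != k ->
  (forall b, b \in W -> u k (s t) <= u k b) -> W = door0.
Proof.
rewrite inE => /and3P[_ /eqP cW /eqP cardW] tk hW.
have sub : W \subset s @: ~: [set k].
  apply/subsetP => b bW; have [/codomP[l eb]|bs] := boolP (b \in codom s); last first.
    by have := hW _ bW; rewrite leqNgt slack_high.
  apply/imsetP; exists l => //; rewrite !inE; apply/negP => /eqP e.
  have := hW _ bW; rewrite leqNgt eb e slack_low //.
  by rewrite (can_eq color_slack).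
have eqW : W = s @: ~: [set k].
  by apply/eqP; rewrite eqEcard sub -ltnS card_slack cardW leqnn.
move: cW; rewrite eqW -imset_comp (eq_imset _ (g := id)) ?imset_id => [|x /=]; last exact: color_slack.
by move=> /setC_inj/set1_inj e; rewrite /door0 e.
Qed.

Lemma door_neighbours (W : {set Z}) : W \in door -> W != door0 ->
  #|[set z | (z \notin W) && dominant (z |: W)]| = 2.
Proof.
move=> Wd W0; have := Wd; rewrite inE => /and3P[domW /eqP cW /eqP cardW].
have Wn0 : W != set0.
  apply: contraNneq W0 => e; move: cW; rewrite e imset0 /door0 => <-.
  by rewrite imset0.
have [m mW m_min] : exists2 m : I -> Z, forall k, m k \in W &
    forall k b, b \in W -> u k (m k) <= u k b.
  have /choice[m hm] : forall k, exists z, z \in W /\ forall b, b \in W -> u k z <= u k b.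
    by move=> k; have [z zW hz] := argmin_exists k Wn0; exists z.
  by exists m => k; have [] := hm k.
have [i [j [ij mij]]] : exists i j, i != j /\ m i = m j.
  have : ~ {in setT &, injective m}.
    move=> minj; have : #|m @: setT| <= #|W|.
      by apply: subset_leq_card; apply/subsetP => _ /imsetP[k _ ->].
    by rewrite card_in_imset // cardsT -cardW ltnn.
  move=> ninj; apply: contrapT => H; apply: ninj => k l _ _ e.
  by apply/eqP; apply: contraPT isT => kl _; apply: H; exists k, l.
(* Both candidate sets are nonempty: by [door_eq_slack], a slack failing to beat some other minimum
   would make [W] equal to [door0]. *)
have above_n0 t : s t \in above m t.
  apply/aboveP => k kt; rewrite ltnNge; apply/negP => le.
  move/negP: W0; apply; apply/eqP; apply: (@door_eq_slack W t k) => //; first by rewrite eq_sym.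
  by move=> b bW; apply: leq_trans le (m_min _ _ bW).
have [y yM ymax] := arg_maxnP (u i) (above_n0 i).
have [z zM zmax] := arg_maxnP (u j) (above_n0 j).
have ji : j != i by rewrite eq_sym.
have [yW ydom] := argmax_above domW mW m_min ij mij yM ymax.
have [zW zdom] := argmax_above domW mW m_min ji (esym mij) zM zmax.
have yz : y != z.
  apply/eqP => e; have := above_le_min domW mW zM (mW j).
  by rewrite -e leqNgt; have /aboveP/(_ j ji) := yM => ->.
suff -> : [set z | (z \notin W) && dominant (z |: W)] = [set y; z] by rewrite cards2 yz.
apply/setP => x; rewrite !inE; apply/idP/idP; last by move=> /orP[]/eqP->; apply/andP.
case/andP => xW xdom; have [k hk [xM xmax]] := neighbour_above cardW mW m_min ij mij xW xdom.
case/orP: hk => /eqP ek; rewrite ek in xM xmax; apply/orP; [left|right]; apply/eqP.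
  by apply: (u_inj (i := i)); apply/eqP; rewrite eqn_leq; apply/andP; split; [apply: ymax|apply: xmax].
by apply: (u_inj (i := j)); apply/eqP; rewrite eqn_leq; apply/andP; split; [apply: zmax|apply: xmax].
Qed.

Lemma slack_lt i z : z \notin codom s -> u i (s i) < u i z.
Proof. by move=> zs; apply: slack_low; apply: contraNneq zs => ->; apply: codom_f. Qed.

Lemma door0_door : door0 \in door.
Proof.
rewrite inE color_door0 eqxx card_slack eqxx !andbT; apply/dominantP => y.
have [/codomP[l ->]|ys] := boolP (y \in codom s).
  exists l => b _; have [->//|bl] := eqVneq b (s l).
  exact/ltnW/slack_low.
exists i0 => b /imsetP[l]; rewrite !inE => li0 ->.
by apply/ltnW/slack_high.
Qed.

(** For [k != i0] the slack [s k] is the lowest point of order [k], so a non-slack point can only be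
    dominated through [i0]; the new element must be the [i0]-highest non-slack point. *)
Lemma door0_neighbours (z0 : Z) : z0 \notin codom s ->
  #|[set z | (z \notin door0) && dominant (z |: door0)]| = 1.
Proof.
move=> z0s; have [y ys ymax] := @arg_maxnP _ z0 [pred z | z \notin codom s] (u i0) z0s.
suff -> : [set z | (z \notin door0) && dominant (z |: door0)] = [set y] by rewrite cards1.
have s0 l : l != i0 -> s l \in door0 by move=> li; apply: imset_f; rewrite !inE.
apply/setP => z; rewrite !inE; apply/idP/idP.
  case/andP => zW /dominantP zdom.
  have key w : w \notin codom s -> u i0 w <= u i0 z.
    move=> ws; have [k hk] := zdom w.
    have [<-|ki] := eqVneq k i0; first by apply: hk; rewrite setU11.
    have := hk (s k); rewrite in_setU1 s0 // orbT => /(_ isT).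
    by rewrite leqNgt slack_lt.
  have zs : z \notin codom s.
    apply/negP => /codomP[l zl]; have [e|li] := eqVneq l i0; last by rewrite zl s0 in zW.
    by have := key _ z0s; rewrite zl e leqNgt slack_lt.
  apply/eqP/(u_inj (i := i0)); apply/eqP; rewrite eqn_leq key // andbT.
  exact: ymax.
move=> /eqP->; apply/andP; split.
  by apply: contra ys => /imsetP[l _ ->]; apply: codom_f.
apply/dominantP => w; have [/codomP[l ->]|ws] := boolP (w \in codom s).
  exists l => b _; have [->//|bl] := eqVneq b (s l).
  exact/ltnW/slack_low.
exists i0 => b; rewrite in_setU1 => /orP[/eqP->|/imsetP[l]]; first exact: ymax.
by rewrite !inE => li0 ->; apply/ltnW/slack_high.
Qed.

(** If removing [z] leaves all colours but [i0], the colouring is injective on the rest and exactly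
    one [z'] there repeats the colour of [z]; only the removal of [z] or of [z'] then gives a
    door. *)
Lemma cell_doors_even (V : {set Z}) : V \in cell -> c @: V != setT ->
  ~~ odd #|[set z in V | c @: (V :\ z) == ~: [set i0]]|.
Proof.
rewrite inE => /andP[_ /eqP cardV] cV.
have [->|/set0Pn[z]] := eqVneq [set z in V | c @: (V :\ z) == ~: [set i0]] set0.
  by rewrite cards0.
rewrite inE => /andP[zV /eqP cz].
have Vz : c z |: (c @: (V :\ z)) = c @: V by rewrite -imsetU1 setD1K.
have czi : c z != i0 by apply: contraNneq cV => e; rewrite -Vz cz e setUCr.
have cinj : {in V :\ z &, injective c}.
  apply/imset_injP; rewrite cz cardsC1 -cardV (cardsD1 z V) zV.
  by rewrite add1n.
have : c z \in c @: (V :\ z) by rewrite cz !inE.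
case/imsetP => z' z'V e.
have zz' : z != z' by move: z'V; rewrite !inE eq_sym => /andP[].
suff -> : [set z in V | c @: (V :\ z) == ~: [set i0]] = [set z; z'] by rewrite cards2 zz'.
apply/setP => w; rewrite !inE; apply/idP/idP; last first.
  case/orP => /eqP->; first by rewrite zV cz eqxx.
  move: (z'V); rewrite !inE => /andP[_ ->] /=; rewrite -cz eqEsubset; apply/andP; split.
    apply/subsetP => _ /imsetP[x /setD1P[xz' xV] ->].
    by have [->|xz] := eqVneq x z; [rewrite e|]; apply: imset_f => //; rewrite !inE xz xV.
  apply/subsetP => _ /imsetP[x /setD1P[xz xV] ->].
  have [->|xz'] := eqVneq x z'; last by apply: imset_f; rewrite !inE xz' xV.
  by rewrite -e; apply: imset_f; rewrite !inE zz' zV.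
case/andP => wV /eqP cw; apply: contraT; rewrite negb_or => /andP[wz wz'].
have wVz : w \in V :\ z by rewrite !inE wz wV.
have : c w \in c @: (V :\ w) by rewrite cw -cz imset_f.
case/imsetP => x; rewrite !inE => /andP[xw xV] ex.
have [xz|xz] := eqVneq x z.
  have : w = z' by apply: cinj => //; rewrite ex xz e.
  by move=> wz'e; rewrite wz'e eqxx in wz'.
have : w = x by apply: cinj => //; rewrite !inE xz xV.
by move=> wx; rewrite wx eqxx in xw.
Qed.

(** Double counting of incidences: [W] and [z] on the left match [z |: W] and [z] on the right. *)
Lemma sum_doors_cells :
  \sum_(W in door) #|[set z | (z \notin W) && dominant (z |: W)]| =
  \sum_(V in cell) #|[set z in V | c @: (V :\ z) == ~: [set i0]]|.
Proof.
under eq_bigr do rewrite -sum1_card.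
under [RHS]eq_bigr do rewrite -sum1_card.
rewrite (exchange_big_dep xpredT) //= [RHS](exchange_big_dep xpredT) //=.
apply: eq_bigr => z _.
rewrite (reindex_onto (fun V => V :\ z) (fun W => z |: W)) /=; last first.
  by move=> W /andP[_]; rewrite inE => /andP[zW _]; rewrite setU1K.
apply: eq_bigl => V; rewrite !inE eqxx /=.
have [zV|zV] := boolP (z \in V); last first.
  rewrite !andbF; apply/negbTE/negP => /andP[_ /eqP e].
  by rewrite -e setU11 in zV.
rewrite setD1K // eqxx andbT (cardsD1 z V) zV add1n.
have [domV|] := boolP (dominant V); last by rewrite !andbF.
rewrite (dominant_sub (subD1set _ _) domV) /= andbT.
by rewrite andbC.
Qed.

(* Doors and cells form a bipartite graph in which every door but [door0] has
   two neighbours, and a cell missing a colour has an even number of them. *)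
Theorem scarf (z0 : Z) : z0 \notin codom s ->
  exists V : {set Z}, dominant V /\ c @: V = setT.
Proof.
move=> z0s; apply: contrapT => H.
have : odd (\sum_(W in door) #|[set z | (z \notin W) && dominant (z |: W)]|).
  rewrite (bigD1 door0) ?door0_door //= (door0_neighbours z0s) add1n /=.
  rewrite (eq_bigr (fun=> 2)) => [|W /andP[Wd W0]]; last exact: door_neighbours.
  by rewrite sum_nat_const oddM andbF.
rewrite sum_doors_cells; apply/negP.
elim/big_ind: _ => // [x y|V Vc]; first by rewrite oddD => /negbTE-> /negbTE->.
apply: cell_doors_even => //; apply/eqP => e; apply: H; exists V; split=> //.
by move: Vc; rewrite inE => /andP[].
Qed.

End Scarf.

(** * Scarf's lemma on a grid of the simplex *)

Section Grid.
Import mathcomp.boot.fintype mathcomp.boot.finset.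
Local Open Scope nat_scope.
Local Open Scope set_scope.

Variables (n N : nat) (c : ('I_n.+1 -> nat) -> 'I_n.+1).

Definition grid_vertex : predArgType :=
  {x : {ffun 'I_n.+1 -> 'I_N.+1} | \sum_i (x i : nat) == N}.

Definition grid_size : nat := #|{: grid_vertex}|.

Definition coord (x : grid_vertex) (i : 'I_n.+1) : nat := val x i.

(* Vertices are ordered by their [i]th coordinate, ties being broken by
   [enum_rank]; slack [i] lies below all of them and the other slacks above. *)
Definition grid_height (i : 'I_n.+1) (z : grid_vertex + 'I_n.+1) : nat :=
  match z with
  | inl x => (coord x i * grid_size + enum_rank x).+1
  | inr j => if j == i then 0 else (N.+1 * grid_size + j).+1
  end.

Definition grid_color (z : grid_vertex + 'I_n.+1) : 'I_n.+1 :=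
  match z with inl x => c (coord x) | inr j => j end.

Lemma coord_sum x : \sum_i coord x i = N.
Proof. exact/eqP/(valP x). Qed.

Lemma coord_le x i : coord x i <= N.
Proof. by rewrite -ltnS /coord. Qed.

Lemma grid_vertexP (y : 'I_n.+1 -> nat) : \sum_i y i = N ->
  exists x, coord x =1 y.
Proof.
move=> ysum; have yN i : y i < N.+1 by rewrite ltnS -ysum (bigD1 i) //= leq_addr.
pose x : {ffun 'I_n.+1 -> 'I_N.+1} := [ffun i => inord (y i)].
have xP : \sum_i (x i : nat) == N.
  by rewrite -[X in _ == X]ysum; apply/eqP/eq_bigr => i _; rewrite ffunE inordK.
by exists (Sub x xP : grid_vertex) => i; rewrite /coord /= ffunE inordK.
Qed.

Lemma grid_height_inl_bound i x : 0 < grid_height i (inl x) <= N.+1 * grid_size.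
Proof.
rewrite /= mulSn addnC -addSn leq_add //.
by rewrite leq_mul2r coord_le orbT.
Qed.

Lemma grid_height_inj i : injective (grid_height i).
Proof.
move=> [x|j] [y|k].
- move=> [] e; congr inl; apply: enum_rank_inj; apply: val_inj => /=.
  have := congr1 (modn^~ grid_size) e.
  by rewrite !modnMDl !modn_small ?ltn_ord.
- have := grid_height_inl_bound i x; move: (grid_height _ (inl x)) => h hx.
  by rewrite /=; case: eqP => _ e; lia.
- have := grid_height_inl_bound i y; move: (grid_height _ (inl y)) => h hx.
  by rewrite /=; case: eqP => _ e; lia.
rewrite /=; case: eqP => [->|_]; case: eqP => [->|_] // [] /addnI e.
by congr inr; apply: val_inj.
Qed.

Lemma notin_codom_inl (z : grid_vertex + 'I_n.+1) : z \notin codom inr ->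
  exists x, z = inl x.
Proof. by case: z => [x|j]; [exists x|rewrite codom_f]. Qed.

Lemma coord_le_height i x y :
  grid_height i (inl x) <= grid_height i (inl y) -> coord x i <= coord y i.
Proof.
rewrite /= ltnS; apply: contraTT; rewrite -!ltnNge => lt.
have : enum_rank y < grid_size by apply: ltn_ord.
move: (enum_rank x : nat) (enum_rank y : nat) => p q.
have := leq_mul2r grid_size (coord y i).+1 (coord x i).
rewrite lt orbT mulSn; lia.
Qed.

(** A slack in the fully coloured dominant set marks a coordinate that is at most [n]; every other
    colour is carried by a grid vertex, and dominance keeps the vertices of the set within [n] of
    each other in each coordinate. *)
Theorem grid_scarf :
  exists b : 'I_n.+1 -> nat, \sum_i b i = N /\
    forall i, b i <= n \/ exists b', [/\ \sum_i b' i = N, c b' = i &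
      forall k, b' k <= b k + n /\ b k <= b' k + n].
Proof.
have [x0 _] : exists x0, coord x0 =1 (fun i => if i == ord0 then N else 0).
  by apply: grid_vertexP; rewrite -big_mkcond big_pred1_eq.
have [V [/dominantP domV colV]] : exists V, dominant grid_height V /\ grid_color @: V = setT.
  apply: (@scarf _ _ grid_height inr grid_color _ _ _ _ ord0 (inl x0)).
  - exact: grid_height_inj.
  - move=> i [x|j] ji; rewrite /= eqxx //.
    by have /negbTE-> : j != i by apply: contraNneq ji => ->.
  - move=> i j z ji /notin_codom_inl[x ->].
    by rewrite /= (negbTE ji); have := grid_height_inl_bound i x; rewrite /=; lia.
  - by [].
  - by apply/negP => /codomP[].
pose A : pred 'I_n.+1 := [pred i | inr i \notin V].
(* Slack [i] has height 0 in order [i], so an order whose slack is in [V] never dominates a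
   vertex. *)
have domX x : exists2 i, i \in A & forall b, inl b \in V -> coord x i <= coord b i.
  have [i hi] := domV (inl x); exists i; last by move=> b /hi /coord_le_height.
  by rewrite inE; apply/negP => /hi; rewrite /= eqxx.
have colA i : i \in A -> exists2 b, inl b \in V & c (coord b) = i.
  move=> iA; have : i \in grid_color @: V by rewrite colV inE.
  case/imsetP => -[b|j] bV /= e; first by exists b.
  by move: iA; rewrite inE e bV.
have [i1 i1A _] := domX x0; have [b0 b0V _] := colA i1 i1A.
have /choice[m mP] : forall i, exists mi,
    (exists2 b, inl b \in V & mi = coord b i) /\
    forall b, inl b \in V -> mi <= coord b i.
  move=> i.
  have [b bV hb] := @arg_minnP _ b0 [pred b | inl b \in V] (fun b => coord b i) b0V.
  by exists (coord b i); split; [exists b|exact: hb].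
have m_le i b : inl b \in V -> m i <= coord b i by case: (mP i) => _; apply.
(* Otherwise all minima over [A] can be raised by one within the total [N], as [A] has at most
   [n.+1] elements; with the surplus put on [i1], the resulting vertex beats every minimum. *)
have sumA : N <= \sum_(i in A) m i + n.
  rewrite leqNgt; apply/negP => lt; set S := \sum_(i in A) (m i).+1.
  have SN : S <= N.
    rewrite /S; under eq_bigr do rewrite -addn1.
    rewrite big_split /= sum1_card; apply: leq_trans lt.
    by rewrite -addnS leq_add2l; apply: leq_trans (max_card _) _; rewrite card_ord.
  have [x xE] : exists x, coord x =1
      (fun i => (if i \in A then (m i).+1 else 0) + (if i == i1 then N - S else 0)).
    apply: grid_vertexP; rewrite big_split /= -!big_mkcond /= big_pred1_eq.
    by rewrite -/S subnKC.
  have [i iA hi] := domX x; have [[b bV mb] _] := mP i.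
  by have := hi b bV; rewrite xE iA -mb; lia.
(* The minima over [A] use up all but [n] of the total [N], so no coordinate exceeds its lower bound
   ([m k] on [A], 0 elsewhere) by more than [n]. *)
have near (b : grid_vertex) (k : 'I_n.+1) : inl b \in V -> (k \in A -> coord b k <= m k + n) /\
    (k \notin A -> coord b k <= n).
  move=> bV; have := coord_sum b; rewrite (bigID (fun i => i \in A)) /= => sb.
  split=> kA.
    have : \sum_(i in A | i != k) m i <= \sum_(i in A | i != k) coord b i.
      by apply: leq_sum => l _; apply: m_le.
    by move: sb sumA; rewrite (bigD1 k) //= [X in _ <= X + _](bigD1 k) //=; lia.
  have : \sum_(i in A) m i <= \sum_(i in A) coord b i.
    by apply: leq_sum => l _; apply: m_le.
  move: sb; rewrite [X in _ + X](bigD1 k) //= => sb le.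
  have := leq_trans sumA (leq_add le (leqnn n)).
  by rewrite -sb leq_add2l; apply: leq_trans; apply: leq_addr.
exists (coord b0); split; first exact: coord_sum.
move=> i; have [iA|iA] := boolP (i \in A); last by left; apply: (near b0 i b0V).2.
right; have [b bV cb] := colA i iA; exists (coord b); split => // [|k].
  exact: coord_sum.
have [] := near b k bV; have [] := near b0 k b0V; have := m_le k b bV.
have := m_le k b0 b0V; have [kA|kA] := boolP (k \in A).
  by move=> h1 h2 /(_ isT) h3 _ /(_ isT) h4 _; lia.
by move=> h1 h2 _ /(_ isT) h3 _ /(_ isT) h4; lia.
Qed.

End Grid.

(** * Fixed-point theorems *)

Lemma compact_cluster_seq (R : realType) (V : normedModType R) (Q : set V) (u : nat -> V) :
  compact Q -> (forall n, Q (u n)) ->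
  exists2 q, Q q & forall d : R, 0 < d -> forall N, exists2 n, (N <= n)%N & `|u n - q| < d.
Proof.
move=> cQ uQ; have [|q [Qq clq]] := cQ (u @ \oo) _; first by exists 0%N => // n _; apply: uQ.
exists q => // d d0 N.
have [_ [[n Nn <-] hn]] := clq (u @` [set n | (N <= n)%N]) (ball q d)
  (ex_intro2 _ _ N I (fun n Nn => ex_intro2 _ _ n Nn erefl)) (nbhsx_ballx q d d0).
by exists n => //; move: hn; rewrite -ball_normE /= distrC.
Qed.

Lemma inv_nat_lt (R : realType) (e : R) : 0 < e -> exists N : nat, forall n, (N <= n)%N -> n.+1%:R^-1 < e :> R.
Proof.
move=> e0; have [N hN] : exists N : nat, e^-1 < N%:R.
  by exists (Num.bound e^-1); apply: archi_boundP; rewrite invr_ge0 ltW.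
exists N => n Nn; rewrite invf_plt ?posrE ?ltr0n //.
by apply: lt_le_trans hN _; rewrite ler_nat (leq_trans Nn).
Qed.

(** * Brouwer's theorem on the simplex *)

Section Brouwer.
Variables (R : realType) (n : nat).
Implicit Types (t : 'I_n.+1 -> R).

Definition simplex t : Prop := (forall i, 0 <= t i) /\ \sum_i t i = 1.

Definition simplex_continuous (h : ('I_n.+1 -> R) -> 'I_n.+1 -> R) : Prop :=
  forall t, simplex t -> forall i (e : R), 0 < e -> exists2 d : R, 0 < d &
    forall t', simplex t' -> (forall k, `|t' k - t k| < d) -> `|h t' i - h t i| < e.

Lemma simplex_le1 t i : simplex t -> t i <= 1.
Proof.
by case=> t0 <-; rewrite (bigD1 i) //= lerDl; apply: sumr_ge0 => j _.
Qed.

Lemma simplex_exists_le t t' : simplex t -> simplex t' -> exists i, t i <= t' i.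
Proof.
move=> [_ st] [_ st']; apply: contrapT => H.
suff : \sum_i t' i < \sum_i t i by rewrite st st' ltxx.
apply: ltr_sum => [|i _]; first by apply/hasP; exists ord0; rewrite ?mem_index_enum.
by rewrite ltNge; apply/negP => le; apply: H; exists i.
Qed.

(** A grid point is coloured by an index at which [h] does not decrease the coordinate. At a cluster
    point [t] of finer and finer grids, [t i <= h t i] for all [i]; both sides sum to 1, hence
    equality. *)
Theorem brouwer_simplex h : simplex_continuous h ->
  (forall t, simplex t -> simplex (h t)) -> exists2 t, simplex t & h t = t.
Proof.
move=> hc hS.
pose pt (N : nat) (b : 'I_n.+1 -> nat) i : R := (b i)%:R / N.+1%:R.
pose mesh (N : nat) : R := n%:R / N.+1%:R.
have ptS N b : (\sum_i b i = N.+1)%N -> simplex (pt N b).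
  move=> sb; split=> [i|]; first by rewrite divr_ge0.
  by rewrite -mulr_suml -natr_sum sb divff // pnatr_eq0.
have /choice[b bP] : forall N, exists b : 'I_n.+1 -> nat, (\sum_i b i)%N = N.+1 /\
    forall i, (b i <= n)%N \/ exists b', [/\ (\sum_i b' i)%N = N.+1,
      pt N b' i <= h (pt N b') i & forall k, `|pt N b' k - pt N (b) k| <= mesh N].
  move=> N.
  have /choice[c cP] : forall b : 'I_n.+1 -> nat, exists i, (\sum_i b i = N.+1)%N ->
      pt N b i <= h (pt N b) i.
    move=> b; have [sb|nb] := pselect ((\sum_i b i)%N = N.+1).
      by have [i le] := simplex_exists_le (ptS N b sb) (hS _ (ptS N b sb)); exists i.
    by exists ord0.
  have [b [sb hb]] := grid_scarf N.+1 c; exists b; split=> // i.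
  have [le|[b' [sb' cb' near]]] := hb i; first by left.
  right; exists b'; split=> //.
    by rewrite -cb'; apply: cP.
  move=> k; rewrite /pt -mulrBl normrM normfV [`|_.+1%:R|]ger0_norm //.
  rewrite ler_wpM2r ?invr_ge0 // ler_distl; have [h1 h2] := near k.
  by rewrite lerBlDr -!natrD !ler_nat h1 h2.
pose u N : 'rV[R]_n.+1 := \row_i pt N (b N) i.
have box : compact [set v : 'rV[R]_n.+1 | forall i, `[0, 1]%classic (v ord0 i)].
  by apply: (@rV_compact R n.+1 (fun=> `[0, 1]%classic)) => i; apply: segment_compact.
have [|x _ clx] := compact_cluster_seq (u := u) box.
  move=> N i /=; rewrite mxE in_itv /=; have [sb _] := bP N.
  have := ptS N _ sb => S; rewrite (simplex_le1 _ S) andbT; by case: S.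
pose t : 'I_n.+1 -> R := fun i => x ord0 i.
have clx' (d : R) : 0 < d -> exists N, mesh N < d /\
    forall i, `|pt N (b N) i - t i| < d.
  (* Dividing by [n.+1] makes the mesh [n / N.+1] smaller than [d] as well. *)
  move=> d0; have [N0 hN0] := @inv_nat_lt R (d / n.+1%:R) (divr_gt0 d0 (ltr0Sn _ _)).
  have [N NN hN] := clx d d0 N0; exists N; split.
    have := hN0 N NN; rewrite ltr_pdivlMr ?ltr0n // mulrC; apply: le_lt_trans.
    by rewrite ler_wpM2r ?invr_ge0 // ler_nat.
  move=> i; apply: le_lt_trans hN; rewrite [X in _ <= X]mx_normrE.
  have := le_bigmax _ (fun i => `|(u N - x) i.1 i.2|) (ord0, i).
  by rewrite /= !mxE /t.
have tS : simplex t.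
  split=> [i|].
    rewrite leNgt; apply/negP => lt.
    have [N [_ /(_ i)]] : exists N, mesh N < - t i /\
        forall k, `|pt N (b N) k - t k| < - t i by apply: clx'; rewrite oppr_gt0.
    have [/(_ i) + _] := ptS N _ (bP N).1; rewrite ltr_norml => h0 /andP[_].
    by move: h0; lra.
  apply/eqP; rewrite -subr_eq0 -normr_le0 leNgt; apply/negP => lt.
  have [N [_ hN]] := clx' _ (divr_gt0 lt (ltr0Sn R n)).
  have [_ s1] := ptS N _ (bP N).1.
  suff : `|\sum_i t i - 1| < `|\sum_i t i - 1| by rewrite ltxx.
  rewrite -{1}s1 -sumrB; apply: le_lt_trans (ler_norm_sum _ _ _) _.
  have : \sum_i `|t i - pt N (b N) i| < \sum_(i < n.+1) (`|\sum_i t i - 1| / n.+1%:R).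
    apply: ltr_sum => [|i _]; first by apply/hasP; exists ord0; rewrite ?mem_index_enum.
    by rewrite distrC; apply: hN.
  by rewrite sumr_const card_ord -[X in _ < X -> _]mulr_natr divfK ?pnatr_eq0.
have le_h i : t i <= h t i.
  rewrite leNgt; apply/negP => lt; pose eta : R := t i - h t i.
  have eta0 : 0 < eta / 4 by rewrite divr_gt0 // subr_gt0.
  have [d d0 hd] := hc t tS i _ eta0.
  pose del : R := Num.min d (eta / 4).
  have del0 : 0 < del / 2 by rewrite divr_gt0 // lt_min d0.
  have deld : del <= d by rewrite ge_min lexx.
  have dele : del <= eta / 4 by rewrite ge_min lexx orbT.
  (* If [b N i <= n], then [t i] is too small to exceed [h t i >= 0] by [eta]; otherwise continuity
     at the nearby [b'] contradicts the choice of its colour. *)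
  have [N [nN near]] := clx' _ del0; have [_ /(_ i)[le|[b' [sb' le near']]]] := bP N.
    have := near i; rewrite ltr_norml => /andP[].
    have : pt N (b N) i <= mesh N by rewrite ler_wpM2r ?invr_ge0 // ler_nat.
    have [/(_ i) + _] := hS _ tS; move: dele del0 nN; rewrite /eta; lra.
  have near2 k : `|pt N b' k - t k| < del.
    apply: le_lt_trans (ler_distD (pt N (b N) k) _ _) _.
    by have := near k; have := near' k; move: nN; lra.
  have := hd _ (ptS N _ sb') (fun k => lt_le_trans (near2 k) deld).
  have := near2 i; rewrite !ltr_norml => /andP[+ _] /andP[_].
  move: le dele eta0; rewrite /eta; lra.
exists t => //; apply/funext => i; apply/eqP; rewrite -subr_eq0.
have : \sum_i (h t i - t i) = 0 by rewrite sumrB (hS t tS).2 tS.2 subrr.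
move/eqP; rewrite psumr_eq0 => [|j _]; last by rewrite subr_ge0.
by move/allP/(_ i (mem_index_enum _)).
Qed.

End Brouwer.

(** * Convex combinations and finite nets in a normed space *)

Section NormedPreliminaries.
Variables (R : realType) (X : normedModType R).
Implicit Types (A C : set X) (x y z : X).

Lemma dist_lt_trans y x z (a b c : R) :
  `|x - y| < a -> `|y - z| < b -> a + b <= c -> `|x - z| < c.
Proof.
move=> xy yz abc; apply: le_lt_trans (ler_distD y _ _) _.
by apply: lt_le_trans abc; apply: ltrD.
Qed.

Lemma within_continuousP (Y : normedModType R) C (g : X -> Y) :
  {within C, continuous g} <->
  forall x, C x -> forall e : R, 0 < e -> exists2 d : R, 0 < d &
    forall y, C y -> `|y - x| < d -> `|g y - g x| < e.
Proof.
split=> [/subspace_continuousP gC x Cx e e0|gC].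
  have /cvgrPdist_lt/(_ e e0) := gC x Cx.
  rewrite near_withinE => /nbhs_normP[d d0 hd]; exists d => // y Cy yx.
  by rewrite distrC; apply: (hd y _ Cy); rewrite /ball_ /= distrC.
apply/subspace_continuousP => x Cx; apply/cvgrPdist_lt => e e0.
have [d d0 hd] := gC x Cx e e0.
rewrite near_withinE; apply/nbhs_normP; exists d => // y.
by rewrite /ball_ /= distrC => yx Cy; rewrite distrC; apply: hd.
Qed.

Lemma convex_setP A :
  @convex_set R X A <->
  forall x y (t : R), A x -> A y -> 0 <= t -> t <= 1 -> A (t *: x + (1 - t) *: y).
Proof.
split=> [cA x y t Ax Ay t0 t1|cA x y p].
  have ht : (0 : R) <= t <= 1 by rewrite t0 t1.
  have := cA x y (Itv01 t0 t1); rewrite !inE; exact.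
rewrite !inE => Ax Ay; apply: cA => //.
Qed.

Lemma convex_avg A n (w : 'I_n -> R) (z : 'I_n -> X) : @convex_set R X A ->
  (forall i, 0 <= w i) -> 0 < \sum_i w i -> (forall i, 0 < w i -> A (z i)) ->
  A ((\sum_i w i)^-1 *: \sum_i w i *: z i).
Proof.
move=> /convex_setP cA; elim: n w z => [|n IH] w z w0; first by rewrite big_ord0 ltxx.
rewrite !big_ord_recl; set S := \sum_i w _; set T := \sum_i _ *: _ => S0 wz.
have Sge : 0 <= S by apply: sumr_ge0.
have [e|Sn] := eqVneq S 0.
  have T0 : T = 0.
    apply: big1 => i _; have /eqP := e; rewrite psumr_eq0 // => /allP/(_ i).
    by rewrite mem_index_enum => /(_ isT)/eqP->; rewrite scale0r.
  move: S0; rewrite e T0 !addr0 => S0; rewrite scalerA mulVf ?gt_eqF // scale1r.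
  exact: wz.
have Sp : 0 < S by rewrite lt_neqAle eq_sym Sn.
have AT : A (S^-1 *: T) by apply: IH => // i; apply: wz.
have [e|wn] := eqVneq (w ord0) 0; first by rewrite e scale0r !add0r.
have wp : 0 < w ord0 by rewrite lt_neqAle eq_sym wn w0.
have : A ((w ord0 / (w ord0 + S)) *: z ord0 + (1 - w ord0 / (w ord0 + S)) *: (S^-1 *: T)).
  apply: cA => //; first exact: wz.
    by rewrite divr_ge0 // ltW.
  by rewrite ler_pdivrMr // mul1r lerDl.
congr A; rewrite scalerDr !scalerA; congr (_ *: _ + _ *: _); first by rewrite mulrC.
by field; rewrite !gt_eqF.
Qed.

Definition weighted_avg n (phi : 'I_n -> X -> R) (p : 'I_n -> X) x : X :=
  (\sum_i phi i x)^-1 *: \sum_i phi i x *: p i.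

Lemma weighted_avg_continuous C n (phi : 'I_n -> X -> R) (p : 'I_n -> X) :
  (forall i, {within C, continuous (phi i)}) -> (forall x, C x -> \sum_i phi i x != 0) ->
  {within C, continuous (weighted_avg phi p)}.
Proof.
move=> phiC phi0; apply/subspace_continuousP => x Cx.
have phix i : phi i y @[y --> within C (nbhs x)] --> phi i x.
  by have /subspace_continuousP := phiC i; apply.
apply: cvgZ; first by apply: cvgV; [exact: phi0|apply: cvg_big => //; apply: add_continuous].
apply: cvg_big => [|i _]; first exact: add_continuous.
exact: cvgZr_tmp.
Qed.

(** The same average of the nearby points [z i] stays in [A], at a distance at most the average of
    the distances; one positive weight keeps the bound strict. *)
Lemma weighted_avg_near A n (phi : 'I_n -> X -> R) (p : 'I_n -> X) x (e : R) :
  @convex_set R X A -> (forall i, 0 <= phi i x) -> 0 < \sum_i phi i x ->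
  (forall i, 0 < phi i x -> exists2 z, A z & `|p i - z| < e) ->
  exists2 z, A z & `|weighted_avg phi p x - z| < e.
Proof.
move=> cA phi0 Phi0 hp.
have /choice[z hz] : forall i, exists z, 0 < phi i x -> A z /\ `|p i - z| < e.
  move=> i; have [/hp[z Az pz]|] := boolP (0 < phi i x); first by exists z.
  by exists 0.
exists (weighted_avg phi z x); first by apply: convex_avg => // i /hz[].
rewrite /weighted_avg -scalerBr -sumrB normrZ gtr0_norm ?invr_gt0 // mulrC ltr_pdivrMr //.
apply: le_lt_trans (ler_norm_sum _ _ _) _.
rewrite mulr_sumr; apply: (@lt_le_trans _ _ (\sum_i e * phi i x)) => //.
have hle i : `|phi i x *: p i - phi i x *: z i| <= e * phi i x.
  rewrite -scalerBr normrZ ger0_norm // mulrC.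
  have [->|ph] := eqVneq (phi i x) 0; first by rewrite !mulr0.
  by rewrite ler_wpM2r // ltW //; apply: (hz i _).2; rewrite lt_neqAle eq_sym ph phi0.
have [i phi_i] : exists i, 0 < phi i x.
  apply: contrapT => H; move: Phi0; rewrite big1 ?ltxx // => i _.
  by apply/eqP; rewrite eq_le phi0 andbT leNgt; apply/negP => h; apply: H; exists i.
rewrite (bigD1 i) //= [X in _ < X](bigD1 i) //=; apply: ltr_leD; last exact: ler_sum.
by rewrite -scalerBr normrZ gtr0_norm // mulrC ltr_pM2r //; apply: (hz i _).2.
Qed.

Lemma finite_net A (e : R) : compact A -> A !=set0 -> 0 < e ->
  exists n (p : 'I_n.+1 -> X), (forall i, A (p i)) /\
    forall z, A z -> exists i, `|z - p i| < e.
Proof.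
rewrite compact_cover => cA [q Aq] e0.
have [|z Az|D DA covD] := cA X A (fun x => ball x e).
- by move=> x _; apply: ball_open.
- by exists z => //; apply: ballxx.
(* Putting [q] in front makes the list nonempty, to match the index type ['I_n.+1]. *)
pose s := q :: finmap.enum_fset D.
exists (size (finmap.enum_fset D)), (fun i => nth q s i); split=> [i|z /covD[x xD]].
  have : nth q s i \in s by apply: mem_nth.
  by rewrite inE => /orP[/eqP->//|/DA]; rewrite inE.
rewrite -ball_normE /= => xz.
have xs : x \in s by rewrite inE; apply/orP; right.
have lt : (index x s < size s)%N by rewrite index_mem.
by exists (Ordinal lt); rewrite /= nth_index // distrC.
Qed.

End NormedPreliminaries.

Lemma comp_within_continuous (R : realType) (X Y Z : normedModType R) (C : set X)
  (D : set Y) (g : X -> Y) (h : Y -> Z) :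
  (forall x, C x -> D (g x)) -> {within C, continuous g} -> {within D, continuous h} ->
  {within C, continuous (h \o g)}.
Proof.
move=> gCD /within_continuousP gC /within_continuousP hD; apply/within_continuousP.
move=> x Cx e e0; have [d d0 hd] := hD _ (gCD x Cx) e e0.
have [d' d'0 hd'] := gC x Cx d d0; exists d' => // y Cy yx.
by apply: hd; [apply: gCD|apply: hd'].
Qed.

(* Schauder projection onto the hull of a finite net of the compact set. *)
Lemma approximate_fixpoint (R : realType) (X : normedModType R) (C Q : set X)
  (g : X -> X) (e : R) : C !=set0 -> @convex_set R X C -> compact Q -> Q `<=` C ->
  (forall x, C x -> Q (g x)) -> {within C, continuous g} -> 0 < e ->
  exists2 x, C x & `|x - g x| < e.
Proof.
move=> [x0 Cx0] cC cQ QC gQ gC e0.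
have [n [p [pQ netp]]] := finite_net cQ (ex_intro _ _ (gQ _ Cx0)) e0.
pose phi i x : R := Num.max 0 (e - `|g x - p i|).
have phi0 i x : 0 <= phi i x by rewrite le_max lexx.
have phiC i : {within C, continuous (phi i)}.
  have -> : phi i = (fun y => Num.max 0 (e - `|y - p i|)) \o g by [].
  apply: (comp_within_continuous (D := setT)) => //; apply: continuous_subspaceT.
  move=> y; apply: (@continuous_max R X (fun=> 0) (fun y => e - `|y - p i|) y).
    exact: cvg_cst.
  apply: continuousB; first exact: cvg_cst.
  apply: cvg_norm; apply: continuousB => //; exact: cvg_cst.
have Phi0 x : C x -> 0 < \sum_i phi i x.
  move=> Cx; have [i hi] := netp _ (gQ x Cx).
  rewrite (bigD1 i) //= ltr_pwDl ?sumr_ge0 //.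
  by rewrite lt_max subr_gt0 hi orbT.
pose pt (t : 'I_n.+1 -> R) : X := \sum_i t i *: p i.
have ptC t : simplex t -> C (pt t).
  move=> [t0 t1]; have := @convex_avg _ _ C _ t p cC t0.
  by rewrite t1 invr1 scale1r; apply=> // i _; apply/QC/pQ.
(* The projection of [g] onto the hull of the net, in barycentric coordinates so that Brouwer's
   theorem applies. *)
pose h (t : 'I_n.+1 -> R) i : R := phi i (pt t) / \sum_k phi k (pt t).
have [t tS ht] : exists2 t, simplex t & h t = t.
  apply: brouwer_simplex => [t tS i eta eta0|t tS]; last first.
    split=> [i|]; first by rewrite divr_ge0 // sumr_ge0.
    by rewrite -mulr_suml divff // gt_eqF //; apply/Phi0/ptC.
  have FC : {within C, continuous (fun x => phi i x / \sum_k phi k x)}.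
    apply/subspace_continuousP => x Cx.
    have phix k : phi k y @[y --> within C (nbhs x)] --> phi k x.
      by have /subspace_continuousP := phiC k; apply.
    apply: cvgM => //; apply: cvgV; first by rewrite gt_eqF ?Phi0.
    by apply: cvg_big => //; apply: add_continuous.
  have [d d0 hd] := (within_continuousP _ _).1 FC _ (ptC t tS) eta eta0.
  pose B : R := 1 + \sum_k `|p k|.
  have B0 : 0 < B by rewrite ltr_pwDl ?sumr_ge0.
  exists (d / B); first exact: divr_gt0.
  move=> t' t'S tt'; apply: hd; first exact: ptC.
  rewrite /pt -sumrB; apply: le_lt_trans (ler_norm_sum _ _ _) _.
  apply: (@le_lt_trans _ _ (\sum_k d / B * `|p k|)).
    apply: ler_sum => k _; rewrite -scalerBl normrZ ler_wpM2r //.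
    exact/ltW/tt'.
  by rewrite -mulr_sumr -mulrA gtr_pMr // ltr_pdivrMl // mulr1 /B ltrDr.
exists (pt t); first exact: ptC.
have avgE : weighted_avg phi p (pt t) = pt t.
  rewrite /weighted_avg scaler_sumr; apply: eq_bigr => i _.
  by rewrite scalerA mulrC -[in RHS]ht.
(* The averaging estimate is used with the convex set reduced to the point [g (pt t)]. *)
have cg : @convex_set R X [set g (pt t)].
  apply/convex_setP => _ _ s -> -> _ _ /=.
  by rewrite -scalerDl addrC subrK scale1r.
have [|z ->] := @weighted_avg_near _ _ _ _ phi p (pt t) e cg
  (fun i => phi0 i _) (Phi0 _ (ptC t tS)); last by rewrite avgE.
move=> i hi; exists (g (pt t)) => //; rewrite distrC.
by move: hi; rewrite lt_max ltxx /= subr_gt0.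
Qed.

Theorem schauder (R : realType) (X : normedModType R) (C Q : set X) (g : X -> X) :
  C !=set0 -> @convex_set R X C -> compact Q -> Q `<=` C ->
  (forall x, C x -> Q (g x)) -> {within C, continuous g} ->
  exists2 x, C x & g x = x.
Proof.
move=> C0 cC cQ QC gQ gC.
have /choice[u hu] : forall n, exists x, C x /\ `|x - g x| < n.+1%:R^-1 :> R.
  move=> n; have e0 : 0 < n.+1%:R^-1 :> R by rewrite invr_gt0 ltr0n.
  by have [x Cx hx] := approximate_fixpoint C0 cC cQ QC gQ gC e0; exists x.
(* The cluster point is taken for the images, which lie in [Q]; the points [u n] follow because they
   approach their images. *)
have [q Qq clq] := compact_cluster_seq (u := g \o u) cQ (fun n => gQ _ (hu n).1).
exists q; first exact: QC.
apply: subr0_eq; apply/eqP; rewrite -normr_le0 leNgt; apply/negP => lt.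
have e0 : 0 < `|g q - q| / 2 by rewrite divr_gt0.
have [d d0 hd] := (within_continuousP _ _).1 gC q (QC _ Qq) _ e0.
have d20 : 0 < d / 2 by rewrite divr_gt0.
have [N hN] := inv_nat_lt d20.
have m0 : 0 < Num.min (d / 2) (`|g q - q| / 2) by rewrite lt_min d20 e0.
have [n Nn] := clq _ m0 N; rewrite lt_min /= => /andP[n1 n2].
have [Cu un] := hu n; have n3 := hN n Nn.
have uq : `|u n - q| < d by apply: (dist_lt_trans (lt_trans un n3) n1); rewrite -splitr.
have := hd _ Cu uq; rewrite distrC => gq.
suff : `|g q - q| < `|g q - q| by rewrite ltxx.
by apply: (dist_lt_trans gq n2); rewrite -splitr.
Qed.

(** * Continuous selections *)

Lemma half_pow_lt (R : realType) (B e : R) : 0 < e -> exists k : nat, B / 2 ^+ k < e.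
Proof.
move=> e0; have [N hN] : exists N : nat, `|B| / e < N%:R.
  by exists (Num.bound (`|B| / e)); apply: archi_boundP; rewrite divr_ge0 // ltW.
exists N; rewrite ltr_pdivrMr ?exprn_gt0 //; apply: le_lt_trans (ler_norm B) _.
move: hN; rewrite ltr_pdivrMr // => /lt_trans; apply; rewrite mulrC ltr_pM2l //.
by rewrite -natrX ltr_nat ltn_expl.
Qed.

Lemma closure_normP (R : realType) (X : normedModType R) (A : set X) (z : X) :
  closure A z <-> forall e : R, 0 < e -> exists2 y, A y & `|z - y| < e.
Proof.
split=> [clz e e0|H B /nbhs_normP[e e0 eB]].
  have [y [Ay]] := clz (ball z e) (nbhsx_ballx z e e0).
  by rewrite -ball_normE /= => zy; exists y.
by have [y Ay zy] := H e e0; exists y; split=> //; apply: eB.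
Qed.

Lemma convex_closure (R : realType) (X : normedModType R) (A : set X) :
  @convex_set R X A -> @convex_set R X (closure A).
Proof.
move=> /convex_setP cA; apply/convex_setP => x y t /closure_normP clx /closure_normP cly t0 t1.
apply/closure_normP => e e0.
have [x' Ax' xx'] := clx e e0; have [y' Ay' yy'] := cly e e0.
exists (t *: x' + (1 - t) *: y'); first exact: cA.
rewrite opprD addrACA -!scalerBr.
apply: le_lt_trans (ler_normD _ _) _; rewrite !normrZ ger0_norm // ger0_norm ?subr_ge0 //.
have [->|tn] := eqVneq t 0; first by rewrite mul0r add0r subr0 mul1r.
have tp : 0 < t by rewrite lt_neqAle eq_sym tn.
have -> : e = t * e + (1 - t) * e by rewrite -mulrDl addrC subrK mul1r.
apply: ltr_leD; first by rewrite ltr_pM2l.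
by rewrite ler_wpM2l ?subr_ge0 // ltW.
Qed.

(** * Geometric convergence and dyadic averages in a Banach space *)

Section GeometricLimits.
Variables (R : realType) (X : completeNormedModType R).
Implicit Types (u y : nat -> X) (B : R) (C D S : set X).

Lemma geometric_increments_dist u B : (forall k, `|u k.+1 - u k| <= B / 2 ^+ k) ->
  forall k m, `|u (m + k)%N - u k| <= 2 * B / 2 ^+ k.
Proof.
move=> hu k m.
have B0 : 0 <= B by have := le_trans (normr_ge0 _) (hu 0%N); rewrite expr0 divr1.
suff : `|u (m + k)%N - u k| <= 2 * B / 2 ^+ k - 2 * B / 2 ^+ (m + k).
  by move/le_trans; apply; rewrite gerBl divr_ge0 ?mulr_ge0 ?exprn_ge0.
elim: m => [|m IH]; first by rewrite add0n !subrr normr0.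
apply: le_trans (ler_distD (u (m + k)%N) _ _) _.
apply: le_trans (lerD (hu _) IH) _.
rewrite addSn exprS invfM; set a := (2 ^+ (m + k))^-1.
move: (2 * B / 2 ^+ k) => b; lra.
Qed.

Lemma geometric_increments_cvg u B : (forall k, `|u k.+1 - u k| <= B / 2 ^+ k) ->
  cvgn u /\ forall k, `|limn u - u k| <= 2 * B / 2 ^+ k.
Proof.
move=> hu; have dist := geometric_increments_dist hu.
have cu : cvgn u.
  apply: cauchy_cvg; apply: cauchy_exP => e e0.
  have [k hk] := half_pow_lt (2 * B) e0; exists (u k), k => // n /= kn.
  rewrite -ball_normE /= distrC; apply: le_lt_trans hk.
  by have := dist k (n - k)%N; rewrite subnK.
split=> // k; apply/ler_addgt0Pl => e e0.
have /cvgrPdist_lt/(_ e e0)[N _ hN] := cu.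
have := hN (maxn N k) (leq_maxl N k); rewrite /= => h1.
have := dist k (maxn N k - k)%N; rewrite subnK ?leq_maxr // => h2.
apply: le_trans (ler_distD (u (maxn N k)) _ _) _.
by apply: lerD => //; apply: ltW.
Qed.

Lemma geometric_uniform_limit (Y : normedModType R) (C : set Y) (h : nat -> Y -> X) B :
  (forall k, {within C, continuous (h k)}) ->
  (forall x, C x -> forall k, `|h k.+1 x - h k x| <= B / 2 ^+ k) ->
  {within C, continuous (fun x => limn (h^~ x))}.
Proof.
move=> hC hB; apply/within_continuousP => x Cx e e0.
have e4 : 0 < e / 4 by rewrite divr_gt0.
have e2 : 0 < e / 2 by rewrite divr_gt0.
have [k hk] := half_pow_lt (2 * B) e4.
have [d d0 hd] := (within_continuousP _ _).1 (hC k) x Cx _ e2.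
have near (y : Y) : C y -> `|limn (h^~ y) - h k y| < e / 4.
  by move=> Cy; apply: le_lt_trans hk; apply: (geometric_increments_cvg (hB y Cy)).2.
exists d => // y Cy yx.
apply: (dist_lt_trans (near y Cy) (dist_lt_trans (hd y Cy yx) _ (lexx _)) _).
  by rewrite distrC; apply: near.
lra.
Qed.

(** Dyadic weights are all positive with total 1 in the limit, so every [y i] truly enters
    [geo_avg]. *)
Definition geo_sum y n : X := \sum_(i < n) 2^-1 ^+ i.+1 *: y i.
Definition geo_avg y : X := limn (geo_sum y).

Lemma geo_sumS y n : geo_sum y n.+1 = 2^-1 *: y 0%N + (1 - 2^-1) *: geo_sum (y \o succn) n.
Proof.
rewrite /geo_sum big_ord_recl /= expr1; congr (_ + _).
have -> : 1 - 2^-1 = 2^-1 :> R by lra.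
rewrite scaler_sumr; apply: eq_bigr => i _.
by rewrite scalerA -exprS.
Qed.

Lemma geo_sum_increment y B : (forall i, `|y i| <= B) ->
  forall k, `|geo_sum y k.+1 - geo_sum y k| <= B / 2 ^+ k.
Proof.
move=> yB k; rewrite /geo_sum big_ord_recr /= addrAC subrr add0r normrZ.
rewrite ger0_norm ?exprn_ge0 ?invr_ge0 // mulrC exprS -exprVn.
apply: ler_pM => //; rewrite ?mulr_ge0 ?exprn_ge0 ?invr_ge0 //.
by rewrite ler_piMl ?exprn_ge0 ?invr_ge0 // invf_le1 // ler1n.
Qed.

Lemma geo_avg_cvg y B : (forall i, `|y i| <= B) -> geo_sum y @ \oo --> geo_avg y.
Proof. by move=> yB; apply: (geometric_increments_cvg (geo_sum_increment yB)).1. Qed.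

(** The face property splits two-point combinations only; this recursion exposes one, between the
    head and the average of the tail. *)
Lemma geo_avgS y B : (forall i, `|y i| <= B) ->
  geo_avg y = 2^-1 *: y 0%N + (1 - 2^-1) *: geo_avg (y \o succn).
Proof.
move=> yB; have cy := geo_avg_cvg yB.
have cS : geo_sum (y \o succn) @ \oo --> geo_avg (y \o succn).
  by apply: geo_avg_cvg => i; apply: yB.
have c1 : (fun n => geo_sum y n.+1) @ \oo --> geo_avg y by rewrite (cvg_shiftS (geo_sum y)).
apply: (cvg_unique _ c1); first exact: norm_hausdorff.
rewrite (_ : (fun n => _) = (fun n => 2^-1 *: y 0%N + (1 - 2^-1) *: geo_sum (y \o succn) n)).
  by apply: cvgD; [apply: cvg_cst|apply: cvgZl_tmp].
by apply/funext => n; rewrite geo_sumS.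
Qed.

Lemma geo_avg_mem D y B : @convex_set R X D -> closed D ->
  (forall i, `|y i| <= B) -> (forall i, D (y i)) -> D (geo_avg y).
Proof.
move=> /convex_setP cD clD yB yD.
(* The weights of a partial sum miss [2^-1 ^+ n]; giving this mass to a point of [D] makes a true
   convex combination. *)
have DS n y' z : (forall i, D (y' i)) -> D z -> D (geo_sum y' n + 2^-1 ^+ n *: z).
  elim: n y' => [|n IH] y' y'D Dz; first by rewrite /geo_sum big_ord0 add0r expr0 scale1r.
  rewrite geo_sumS -addrA.
  have -> : 2^-1 ^+ n.+1 *: z = (1 - 2^-1) *: (2^-1 ^+ n *: z).
    by rewrite scalerA exprS; congr (_ * _ *: _); lra.
  rewrite -scalerDr; apply: cD => //; last by lra.
  by apply: IH => // i; apply: y'D.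
have cz : (fun n => geo_sum y n + 2^-1 ^+ n *: y 0%N) @ \oo --> geo_avg y.
  rewrite -[X in _ --> X]addr0 -[X in _ + X](scale0r (y 0%N)).
  apply: cvgD; first exact: geo_avg_cvg yB.
  apply: cvgZr_tmp; apply: cvg_expr.
  by rewrite ger0_norm ?invr_ge0 // invf_lt1 // ltr1n.
apply: (@closed_cvg _ _ _ _ _ D clD _ _ cz).
by apply: nearW => n; apply: DS.
Qed.

(** Each use of the face property puts the head in [S] and leaves the average of the tail in [S],
    ready for the next use. *)
Lemma face_geo_avg D S y B : face D S -> @convex_set R X D -> closed D ->
  (forall i, `|y i| <= B) -> (forall i, D (y i)) -> S (geo_avg y) ->
  forall n, S (y n).
Proof.
move=> [_ _ fS] cD clD yB yD Sy n; elim: n y yB yD Sy => [|n IH] y yB yD;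
  rewrite (geo_avgS yB) => /fS[||||h1 h2] //; try lra;
  try by apply: geo_avg_mem cD clD (fun i => yB i.+1) (fun i => yD i.+1).
exact: (IH (y \o succn) (fun i => yB i.+1) (fun i => yD i.+1)).
Qed.

End GeometricLimits.

Section OpenRadius.
Variables (R : realType) (X : normedModType R) (C U : set X).

(** The supremum is the distance from [x] to the part of [C] outside [U], capped at 1 so that it
    also makes sense when [U] contains [C]. *)
Definition radii (x : X) : set R :=
  [set r | [/\ 0 <= r, r <= 1 & forall y, C y -> `|y - x| < r -> U y]].

Definition open_radius (x : X) : R := sup (radii x).

Lemma radii0 x : radii x 0.
Proof. by split=> // y _; rewrite ltNge normr_ge0. Qed.

Lemma has_sup_radii x : has_sup (radii x).
Proof. by split; [exists 0; apply: radii0|exists 1 => r []]. Qed.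

Lemma open_radius_ge x r : radii x r -> r <= open_radius x.
Proof. exact: (ub_le_sup (has_sup_radii x).2). Qed.

Lemma open_radius_ge0 x : 0 <= open_radius x.
Proof. exact/open_radius_ge/radii0. Qed.

Lemma open_radius_gt0_mem x : C x -> 0 < open_radius x -> U x.
Proof.
move=> Cx r0; have [r [r1 r2 hr] rp] := sup_adherent r0 (has_sup_radii x).
by apply: hr => //; rewrite subrr normr0; move: rp; rewrite subrr.
Qed.

Lemma open_radius_gt0 x (d : R) :
  0 < d -> (forall y, C y -> `|y - x| < d -> U y) -> 0 < open_radius x.
Proof.
move=> d0 hd; apply: (@lt_le_trans _ _ (Num.min d 1)); first by rewrite lt_min d0 ltr01.
apply: open_radius_ge; split; first by rewrite le_min ltW //= ler01.
  by rewrite ge_min lexx orbT.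
by move=> y Cy; rewrite lt_min => /andP[yd _]; apply: hd.
Qed.

Lemma open_radius_lipschitz x y : open_radius x - open_radius y <= `|x - y|.
Proof.
rewrite lerBlDr; apply: ge_sup; first by exists 0; apply: radii0.
move=> r [r0 r1 hr]; rewrite -lerBlDl.
have [le|lt] := leP r `|x - y|.
  by apply: le_trans (open_radius_ge0 y); rewrite subr_le0.
apply: open_radius_ge; split; first by rewrite subr_ge0 ltW.
  by apply: le_trans r1; rewrite gerBl.
move=> z Cz zy; apply: hr => //.
have yx : `|y - x| < `|x - y| + (r - `|x - y| - `|z - y|).
  by rewrite distrC ltrDl subr_gt0.
by apply: (le_lt_trans (ler_distD y z x)); rewrite -ltrBrDl; move: yx; lra.
Qed.

Lemma open_radius_continuous : {within C, continuous open_radius}.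
Proof.
apply/within_continuousP => x Cx e e0; exists e => // y Cy yx.
rewrite ltr_norml; have := open_radius_lipschitz x y.
rewrite distrC => h1; have h2 := open_radius_lipschitz y x.
by apply/andP; split; [rewrite ltrNl opprB|]; apply: le_lt_trans yx.
Qed.

End OpenRadius.

(** * Michael's selection theorem and selections avoiding faces *)

Section Selection.
Variables (R : realType) (X : completeNormedModType R) (C Q : set X).
Implicit Types (G O : X -> set X).

(* The values of [G] are only constrained at points of [C]. *)
Record admissible G : Prop := Admissible {
  admissible_lsc : forall x z, C x -> G x z -> forall e : R, 0 < e ->
    exists2 d : R, 0 < d & forall y, C y -> `|y - x| < d ->
      exists2 z', G y z' & `|z' - z| < e;
  admissible_n0 : forall x, C x -> G x !=set0;
  admissible_convex : forall x, C x -> @convex_set R X (G x);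
  admissible_sub : forall x, C x -> G x `<=` Q }.

Definition open_constraint O : Prop := forall x z, C x -> Q z -> O x z ->
  exists2 d : R, 0 < d & forall y z', C y -> Q z' ->
    `|y - x| < d -> `|z' - z| < d -> O y z'.

(** Lower semicontinuity of [G] supplies points [z'] as close to [z] as desired, and the relatively
    open graph of [O] then contains them. *)
Lemma admissible_setI G O : admissible G -> open_constraint O ->
  (forall x, C x -> G x `&` O x !=set0) ->
  (forall x, C x -> @convex_set R X (O x)) -> admissible (fun x => G x `&` O x).
Proof.
move=> aG oO n0 cO; split=> // [x z Cx [Gz Oz] e e0|x Cx|x Cx z [Gz _]].
- have [d d0 hd] := oO x z Cx (admissible_sub aG Cx Gz) Oz.
  have m0 : 0 < Num.min d e by rewrite lt_min d0.
  have [d' d'0 hd'] := admissible_lsc aG Cx Gz m0.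
  exists (Num.min d d'); first by rewrite lt_min d0.
  move=> y Cy; rewrite lt_min => /andP[yd yd'].
  have [z' Gz' ] := hd' y Cy yd'; rewrite lt_min => /andP[zd ze].
  exists z' => //; split=> //; apply: hd => //.
  exact: (admissible_sub aG Cy).
- apply/convex_setP => y z t [Gy Oy] [Gz Oz] t0 t1.
  by split; [apply: (convex_setP _).1 (admissible_convex aG Cx) _ _ _ Gy Gz t0 t1
            |apply: (convex_setP _).1 (cO x Cx) _ _ _ Oy Oz t0 t1].
- exact: (admissible_sub aG Cx).
Qed.

Lemma convex_dist_lt (c : X) (r : R) : @convex_set R X [set z | `|z - c| < r].
Proof.
apply/convex_setP => x y t /= xr yr t0 t1.
have -> : t *: x + (1 - t) *: y - c = t *: (x - c) + (1 - t) *: (y - c).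
  rewrite !scalerBr addrACA -opprD -scalerDl.
  by rewrite [t + _]addrC subrK scale1r.
apply: le_lt_trans (ler_normD _ _) _; rewrite !normrZ ger0_norm // ger0_norm ?subr_ge0 //.
have [->|tn] := eqVneq t 0; first by rewrite mul0r add0r subr0 mul1r.
have tp : 0 < t by rewrite lt_neqAle eq_sym tn.
have -> : r = t * r + (1 - t) * r by rewrite -mulrDl addrC subrK mul1r.
apply: ltr_leD; first by rewrite ltr_pM2l.
by rewrite ler_wpM2l ?subr_ge0 // ltW.
Qed.

Lemma open_constraint_near (g : X -> X) (r : R) : {within C, continuous g} ->
  open_constraint (fun x => [set z | `|z - g x| < r]).
Proof.
move=> /within_continuousP gC x z Cx Qz /=; rewrite -subr_gt0 => r0.
set s := r - _ in r0; have s2 : 0 < s / 2 by rewrite divr_gt0.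
have [d d0 hd] := gC x Cx _ s2.
exists (Num.min d (s / 2)); first by rewrite lt_min d0.
move=> y z' Cy Qz'; rewrite !lt_min => /andP[yd _] /andP[_ zs] /=.
have := hd y Cy yd; rewrite distrC => gs.
apply: le_lt_trans (ler_distD z _ _) _.
apply: le_lt_trans (lerD (lexx _) (ler_distD (g x) _ _)) _.
have -> : r = s / 2 + (`|z - g x| + s / 2) by rewrite addrCA -splitr /s addrC subrK.
by apply: ltrD => //; rewrite ltrD2l.
Qed.

Definition approx_selection G (e : R) (g : X -> X) : Prop :=
  {within C, continuous g} /\ forall x, C x -> exists2 z, G x z & `|g x - z| < e.

Hypothesis compactQ : compact Q.

(** Each net point is weighted by the [open_radius] of the set where [G x] meets the [e]-ball around
    it. Lower semicontinuity makes this set relatively open, so at every point of [C] some weight is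
    positive. *)
Lemma approx_selection_exists G (e : R) : C !=set0 -> admissible G -> 0 < e ->
  exists g, approx_selection G e g.
Proof.
move=> [x0 Cx0] aG e0; have [z0 Gz0] := admissible_n0 aG Cx0.
have [n [p [_ netp]]] :=
  finite_net compactQ (ex_intro _ z0 (admissible_sub aG Cx0 Gz0)) e0.
pose U i := [set x | exists2 z, G x z & `|p i - z| < e].
pose phi i := open_radius C (U i).
have Phi0 x : C x -> 0 < \sum_i phi i x.
  move=> Cx; have [z Gz] := admissible_n0 aG Cx.
  have [i hi] := netp z (admissible_sub aG Cx Gz).
  rewrite (bigD1 i) //= ltr_pwDl ?sumr_ge0 // => [|k _]; last exact: open_radius_ge0.
  have r0 : 0 < e - `|z - p i| by rewrite subr_gt0.
  have [d d0 hd] := admissible_lsc aG Cx Gz r0.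
  apply: (open_radius_gt0 d0) => y Cy yx; have [z' Gz' zz'] := hd y Cy yx.
  exists z' => //; rewrite distrC; apply: le_lt_trans (ler_distD z _ _) _.
  by rewrite -ltrBrDr.
exists (weighted_avg phi p); split.
  apply: weighted_avg_continuous => [i|x Cx]; first exact: open_radius_continuous.
  by rewrite gt_eqF ?Phi0.
move=> x Cx; apply: weighted_avg_near => //.
- exact: (admissible_convex aG Cx).
- by move=> i; apply: open_radius_ge0.
- exact: Phi0.
- by move=> i phi_i; apply: (open_radius_gt0_mem Cx phi_i).
Qed.

(** Restricting [G] to the [r]-tube around [g] keeps it admissible and forces the finer selection to
    stay near [g]. *)
Lemma approx_selection_refine G (r : R) (g : X -> X) : C !=set0 -> admissible G -> 0 < r ->
  approx_selection G r g ->
  exists2 g', approx_selection G (r / 2) g' & forall x, C x -> `|g' x - g x| <= 2 * r.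
Proof.
move=> C0 aG r0 [gC gG]; have r2 : 0 < r / 2 by rewrite divr_gt0.
have [|g' [g'C g'G]] :=
    @approx_selection_exists (fun x => G x `&` [set z | `|z - g x| < r]) (r / 2) C0 _ r2.
  apply: admissible_setI aG (open_constraint_near gC) _ _ => x Cx; last exact: convex_dist_lt.
  by have [z Gz gz] := gG x Cx; exists z; split=> //=; rewrite distrC.
exists g' => [|x Cx]; first by split=> // x /g'G[z [Gz _] hz]; exists z.
by have [z [_ zr] hz] := g'G x Cx; apply/ltW; apply: (dist_lt_trans hz zr); lra.
Qed.

Theorem michael_selection G : C !=set0 -> admissible G ->
  exists2 g, {within C, continuous g} & forall x, C x -> closure (G x) (g x).
Proof.
move=> C0 aG.
have [g0 hg0] := approx_selection_exists C0 aG ltr01.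
have /choice[step stepP] : forall kg : nat * (X -> X), exists g',
    approx_selection G (1 / 2 ^+ kg.1) kg.2 ->
    approx_selection G (1 / 2 ^+ kg.1.+1) g' /\
    forall x, C x -> `|g' x - kg.2 x| <= 2 / 2 ^+ kg.1.
  move=> [k g] /=; have [hg|ng] := pselect (approx_selection G (1 / 2 ^+ k) g); last by exists g.
  have r0 : 0 < 1 / 2 ^+ k :> R by rewrite divr_gt0 ?exprn_gt0.
  have [g' hg' gg'] := approx_selection_refine C0 aG r0 hg.
  exists g' => _; split=> [|x Cx].
    by have -> : 1 / 2 ^+ k.+1 = 1 / 2 ^+ k / 2 :> R by rewrite exprS invfM !mul1r mulrC.
  by apply: le_trans (gg' x Cx) _; rewrite mulrA mulr1.
pose h := fix h k := if k is k'.+1 then step (k', h k') else g0.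
have hh k : approx_selection G (1 / 2 ^+ k) (h k).
  elim: k => [|k IH]; first by rewrite expr0 divr1.
  by have [] := stepP (k, h k) IH.
have hB x : C x -> forall k, `|h k.+1 x - h k x| <= 2 / 2 ^+ k.
  by move=> Cx k; have [_] := stepP (k, h k) (hh k); apply.
exists (fun x => limn (h^~ x)).
  exact: geometric_uniform_limit (fun k => (hh k).1) hB.
move=> x Cx; apply/closure_normP => e e0.
have e2 : 0 < e / 2 by rewrite divr_gt0.
(* The limit is within [2 * 2 / 2 ^+ k] of [h k x], itself within [1 / 2 ^+ k] of [G x]; the
   constant covers both. *)
have [k hk] := half_pow_lt (2 * 2 + 1) e2.
have [_ /(_ x Cx)[z Gz hz]] := hh k; exists z => //.
have h1 := (geometric_increments_cvg (hB x Cx)).2 k.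
have p0 : 0 < (2 ^+ k)^-1 :> R by rewrite invr_gt0 exprn_gt0.
apply: (dist_lt_trans (le_lt_trans h1 (_ : _ < e / 2)) (lt_trans hz (_ : _ < e / 2)) _).
- by move: hk; lra.
- by move: hk; lra.
- by rewrite -splitr.
Qed.

(** For each scale [k] and net point [p k i], a selection is forced near [p k i] wherever [G x]
    safely meets the ball of radius [inv k] about it, [j] measuring the safety; such triples are
    countable. *)
Lemma dense_selections G : C !=set0 -> admissible G ->
  exists g : nat -> X -> X, [/\ forall n, {within C, continuous (g n)},
    forall n x, C x -> closure (G x) (g n x) &
    forall x z, C x -> G x z -> forall e : R, 0 < e -> exists n, `|z - g n x| < e].
Proof.
move=> C0 aG; have [x0 Cx0] := C0; have [z0 Gz0] := admissible_n0 aG Cx0.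
pose inv k : R := k.+1%:R^-1.
have inv0 k : 0 < inv k by rewrite invr_gt0 ltr0n.
have /choice[p pP] : forall k, exists p : nat -> X, forall z, Q z ->
    exists i, `|z - p i| < inv k.
  move=> k; have [n [p [_ netp]]] :=
    finite_net compactQ (ex_intro _ z0 (admissible_sub aG Cx0 Gz0)) (inv0 k).
  exists (fun i => p (inord i)) => z Qz; have [i hi] := netp z Qz.
  by exists i; rewrite inord_val.
pose U k i := [set x | exists2 z, G x z & `|z - p k i| < inv k].
(* The constraint is imposed only on a closed subset of the relatively open set
   [U k i], which is what makes it an open one; [j] exhausts [U k i]. *)
pose O k i j x := [set z | inv j <= open_radius C (U k i) x -> `|z - p k i| < inv k].
have aO k i j : admissible (fun x => G x `&` O k i j x).
  apply: admissible_setI => //.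
  - move=> x z Cx Qz Oz.
    (* Where the radius reaches [inv j], [z] lies in an open ball; where it is smaller, its
       continuity keeps the constraint void nearby. *)
    have [ge|lt] := leP (inv j) (open_radius C (U k i) x).
      have r0 : 0 < inv k - `|z - p k i| by rewrite subr_gt0; apply: Oz.
      exists (inv k - `|z - p k i|) => // y z' Cy Qz' _ zz' _.
      by apply: le_lt_trans (ler_distD z _ _) _; rewrite -ltrBrDr.
    have r0 : 0 < inv j - open_radius C (U k i) x by rewrite subr_gt0.
    have [d d0 hd] := (within_continuousP _ _).1 (@open_radius_continuous _ _ C (U k i)) x Cx _ r0.
    exists d => // y z' Cy Qz' yx _; rewrite /O /= => ge; exfalso.
    have := hd y Cy yx; rewrite ltr_norml => /andP[_].
    by rewrite ltrD2r ltNge ge.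
  - move=> x Cx; have [ge|lt] := leP (inv j) (open_radius C (U k i) x).
      have [z Gz hz] := open_radius_gt0_mem Cx (lt_le_trans (inv0 j) ge).
      by exists z; split.
    by have [z Gz] := admissible_n0 aG Cx; exists z; split=> //; rewrite /O /= leNgt lt.
  - move=> x Cx; apply/convex_setP => y z t Oy Oz t0 t1 ge.
    by apply: (convex_setP _).1 (@convex_dist_lt (p k i) (inv k)) _ _ _ (Oy ge) (Oz ge) t0 t1.
have /choice[s sP] : forall a : nat * nat * nat, exists s, {within C, continuous s} /\
    forall x, C x -> closure (G x `&` O a.1.1 a.1.2 a.2 x) (s x).
  by move=> a; have [s sC sG] := michael_selection C0 (aO a.1.1 a.1.2 a.2); exists s.
pose idx n : nat * nat * nat := odflt (0, 0, 0)%N (unpickle n).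
exists (fun n => s (idx n)); split.
- by move=> n; apply: (sP _).1.
- by move=> n x Cx; apply: (closure_subset _ ((sP (idx n)).2 x Cx)) => z [].
move=> x z Cx Gz e e0; have e3 : 0 < e / 3 by rewrite divr_gt0.
have [k hk] := inv_nat_lt e3; have {hk} := hk k (leqnn k); rewrite -/(inv k) => hk.
have [i hi] := pP k z (admissible_sub aG Cx Gz).
have Rad0 : 0 < open_radius C (U k i) x.
  have r0 : 0 < inv k - `|z - p k i| by rewrite subr_gt0.
  have [d d0 hd] := admissible_lsc aG Cx Gz r0.
  apply: (open_radius_gt0 d0) => y Cy yx; have [z' Gz' zz'] := hd y Cy yx.
  by exists z' => //; apply: le_lt_trans (ler_distD z _ _) _; rewrite -ltrBrDr.
have [j hj] := inv_nat_lt Rad0; have {hj} := hj j (leqnn j); rewrite -/(inv j) => hj.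
exists (pickle (k, i, j)); rewrite /idx pickleK /=.
have /closure_normP/(_ _ e3)[y [_ Oy] sy] := (sP (k, i, j)).2 x Cx.
have := lt_trans (Oy (ltW hj)) hk; rewrite distrC => yp.
have {}sy : `|y - s (k, i, j) x| < e / 3 by rewrite distrC.
apply: (dist_lt_trans (dist_lt_trans (lt_trans hi hk) yp (lexx _)) sy).
by lra.
Qed.

(* Averaging a dense sequence of selections gives a point that no proper
   closed face can contain without containing the whole value of [G]. *)
Theorem face_avoiding_selection G : C !=set0 -> admissible G ->
  exists2 g, {within C, continuous g} & forall x, C x -> closure (G x) (g x) /\
    forall D S, face D S -> @convex_set R X D -> closed D -> G x `<=` D ->
      closed S -> S (g x) -> G x `<=` S.
Proof.
move=> C0 aG; have [s [sC sG sD]] := dense_selections C0 aG.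
have closedQ : closed Q by apply: compact_closed => //; apply: norm_hausdorff.
have sQ x n : C x -> Q (s n x).
  by move=> Cx; apply: closedQ; apply: (closure_subset (admissible_sub aG Cx) (sG n x Cx)).
have [B hB] : exists B : R, forall z, Q z -> `|z| <= B.
  have [M [_ hM]] := compact_bounded compactQ.
  by exists (M + 1) => z Qz; apply: hM => //; rewrite ltrDl.
have sB x : C x -> forall n, `|s n x| <= B by move=> Cx n; apply/hB/sQ.
exists (fun x => geo_avg (s^~ x)).
  apply: (@geometric_uniform_limit _ _ _ _ (fun k x => geo_sum (s^~ x) k) B).
    move=> k; apply/subspace_continuousP => x Cx.
    apply: cvg_big => [|i _]; first exact: add_continuous.
    by apply: cvgZl_tmp; have /subspace_continuousP := sC i; apply.
  by move=> x Cx k; apply: geo_sum_increment => i; apply: sB.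
move=> x Cx; split.
  apply: geo_avg_mem (sB x Cx) _ => [||n].
  - exact/convex_closure/(admissible_convex aG Cx).
  - exact: closed_closure.
  - exact: sG.
move=> D S fS cD clD GD clS Sg.
have sS n : S (s n x).
  apply: (face_geo_avg fS cD clD (sB x Cx) _ Sg) => i.
  by apply: clD; apply: (closure_subset GD (sG i x Cx)).
move=> z Gz; apply: clS; apply/closure_normP => e e0.
by have [n hn] := sD x z Cx Gz e e0; exists (s n x).
Qed.

End Selection.

(** * The quasioptimization problem *)

Lemma lsc_map_norm (R : realType) (X : normedModType R) (C : set X) (K : X -> set X) :
  lsc_map C K -> forall x z, C x -> K x z -> forall e : R, 0 < e ->
    exists2 d : R, 0 < d & forall y, C y -> `|y - x| < d ->
      exists2 z', K y z' & `|z' - z| < e.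
Proof.
move=> lscK x z Cx Kxz e e0.
have /open_subspaceP[V oV VC] := lscK _ (ball_open z e).
have Vx : (V `&` C) x.
  by rewrite VC; split=> //; split=> //; exists z; split=> //; apply: ballxx.
have /nbhs_normP[d d0 hd] := open_nbhs_nbhs (conj oV Vx.1).
exists d => // y Cy yx.
have : (V `&` C) y by split=> //; apply: hd; rewrite /ball_ /= distrC.
rewrite VC => -[[_ [z' [Kz' zz']]] _]; exists z' => //.
by move: zz'; rewrite -ball_normE /= distrC.
Qed.

Lemma closed_notin_dist (R : realType) (X : normedModType R) (A : set X) (x : X) :
  closed A -> ~ A x -> exists2 d : R, 0 < d & forall y, `|y - x| < d -> ~ A y.
Proof.
move=> clA nAx; apply: contrapT => H; apply/nAx/clA/closure_normP => e e0.
apply: contrapT => H'; apply: H; exists e => // y yx Ay.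
by apply: H'; exists y => //; rewrite distrC.
Qed.

(** * Uniform improvement at the fixed points *)

Section Improvement.
Variables (R : realType) (X : completeNormedModType R) (C Q : set X).
Variables (K : X -> set X) (f : X -> R).
Hypothesis compactQ : compact Q.
Hypothesis QC : Q `<=` C.
Hypothesis KQ : forall x, C x -> K x `<=` Q.
Hypothesis K_lsc : lsc_map C K.
Hypothesis fixK_closed : closed (fixed_points C K).
Hypothesis fC : forall x, C x -> forall e : R, 0 < e -> exists2 d : R, 0 < d &
  forall y, C y -> `|y - x| < d -> `|f y - f x| < e.

(** Otherwise there are fixed points [u n] that [K (u n)] improves by at most [inv n]. Their cluster
    point [q] is fixed by closedness, and lower semicontinuity carries a strict improvement at [q]
    over to nearby [u n]. *)
Lemma uniform_improvement :
  (forall x, fixed_points C K x -> exists2 y, K x y & f y < f x) ->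
  exists2 eps : R, 0 < eps &
    forall x, fixed_points C K x -> exists2 y, K x y & f y < f x - eps.
Proof.
move=> improve; apply: contrapT => H.
pose inv n : R := n.+1%:R^-1.
have inv0 n : 0 < inv n by rewrite invr_gt0 ltr0n.
have /choice[u hu] : forall n, exists x, fixed_points C K x /\
    forall y, K x y -> f x - inv n <= f y.
  move=> n; apply: contrapT => Hn; apply: H; exists (inv n) => // x Fx.
  apply: contrapT => Hx; apply: Hn; exists x; split=> // y Ky.
  by rewrite leNgt; apply/negP => lt; apply: Hx; exists y.
have uQ n : Q (u n) by have [[Cu Ku] _] := hu n; apply: KQ Cu _ Ku.
have [q Qq clq] := compact_cluster_seq compactQ uQ.
have Fq : fixed_points C K q.
  apply/fixK_closed/closure_normP => e e0; have [n _ hn] := clq e e0 0%N.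
  by exists (u n); [apply: (hu n).1|rewrite distrC].
have Cq : C q := Fq.1.
have [y Ky]:= improve q Fq; rewrite -subr_gt0; set s := f q - f y => s0.
have Cy : C y by apply/QC/(KQ Cq).
(* Three errors of [s / 4], from [f] near [y], from [f] near [q] and from [inv n], still add up to
   less than [s]. *)
have s4 : 0 < s / 4 by rewrite divr_gt0.
have [d1 d10 hd1] := fC Cy s4; have [d2 d20 hd2] := fC Cq s4.
have [d3 d30 hd3] := lsc_map_norm K_lsc Cq Ky d10.
have [N hN] := inv_nat_lt s4.
have m0 : 0 < Num.min d2 d3 by rewrite lt_min d20.
have [n Nn] := clq _ m0 N; rewrite lt_min => /andP[n2 n3].
have Cu : C (u n) := (hu n).1.1.
have [z Kz zy] := hd3 _ Cu n3.
have := (hu n).2 z Kz; have := hN n Nn; rewrite -/(inv n).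
have := hd1 z (QC (KQ Cu Kz)) zy; have := hd2 _ Cu n2.
rewrite !ltr_norml => /andP[+ _] /andP[_]; move: s0; rewrite /s; lra.
Qed.

Definition improving (eps : R) (x : X) : set X :=
  [set z | fixed_points C K x -> C z /\ f z < f x - eps].

(** Near a point that is not fixed the constraint stays void, the fixed-point set being closed. At a
    fixed point the strict inequality persists by continuity of [f], whether or not the nearby
    points are fixed. *)
Lemma improving_open eps : open_constraint C Q (improving eps).
Proof.
move=> x z Cx Qz Oz; have [Fx|nFx] := pselect (fixed_points C K x); last first.
  have [d d0 hd] := closed_notin_dist fixK_closed nFx.
  by exists d => // y z' _ _ /hd nFy _ /nFy.
have [Cz] := Oz Fx; rewrite -subr_gt0; set s := _ - f z => s0.
have s2 : 0 < s / 2 by rewrite divr_gt0.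
have [d1 d10 hd1] := fC Cx s2; have [d2 d20 hd2] := fC Cz s2.
exists (Num.min d1 d2); first by rewrite lt_min d10.
move=> y z' Cy Qz'; rewrite !lt_min => /andP[yx _] /andP[_ zz] _.
split; first exact: QC.
have := hd1 _ Cy yx; have := hd2 _ (QC Qz') zz.
rewrite !ltr_norml => /andP[_ +] /andP[+ _]; move: s0; rewrite /s; lra.
Qed.

Lemma improving_convex eps x : quasiconvex C f -> @convex_set R X (improving eps x).
Proof.
move=> qf; apply/convex_setP => y z t Oy Oz t0 t1 Fx.
have [Cy fy] := Oy Fx; have [Cz fz] := Oz Fx.
have [||Cm fm] :=
    (convex_setP _).1 (qf (Num.max (f y) (f z))) y z t _ _ t0 t1.
- by split=> //; rewrite le_max lexx.
- by split=> //; rewrite le_max lexx orbT.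
by split=> //; apply: le_lt_trans fm _; rewrite gt_max fy.
Qed.

End Improvement.

(* A small step from a point of [K x `&` O x] towards any point of [K x] stays
   in [O x], so a face containing the former set contains [K x]. *)
Lemma mem_inside_point (R : realType) (X : completeNormedModType R) (C Q : set X)
  (K O : X -> set X) (x p : X) :
  C x -> K x `<=` Q -> classD (K x) -> open_constraint C Q O ->
  K x `&` O x !=set0 -> closure (K x) p ->
  (forall S, face (closure (K x)) S -> closed S -> S p -> K x `&` O x `<=` S) -> K x p.
Proof.
move=> Cx KQ [cK insideK] oO [u [Ku Ou]] Kp faceS; apply: insideK.
have clcl : closure (closure (K x)) = closure (K x).
  by rewrite -(closure_id _).1 //; apply: closed_closure.
split=> // -[S [fS clS neS] Sp]; rewrite clcl in fS neS.
have sub := faceS S fS clS Sp; have [SK _ fS'] := fS.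
apply: neS; apply/seteqP; split=> // y Ky; apply: clS; apply: closure_subset y Ky => y Ky.
have [d d0 hd] := oO x u Cx (KQ u Ku) Ou.
pose a := `|y - u|; have a0 : 0 <= a by apply: normr_ge0.
have ad : 0 < a + d by lra.
(* The step length [t * a] must be below [d]; the denominator [a + d] covers [a = 0] and gives
   [t < 1]. *)
pose t := d / 2 / (a + d).
have t0 : 0 < t by rewrite !divr_gt0.
have t1 : t < 1 by rewrite ltr_pdivrMr //; lra.
have Kt : K x (t *: y + (1 - t) *: u).
  by apply: (convex_setP _).1 cK _ _ _ Ky Ku (ltW t0) (ltW t1).
have St : S (t *: y + (1 - t) *: u).
  apply: sub; split=> //; apply: hd => //; first exact: KQ.
    by rewrite subrr normr0.
  have -> : t *: y + (1 - t) *: u - u = t *: (y - u).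
    by rewrite scalerBl scale1r scalerBr addrCA [LHS]addrC addKr.
  rewrite normrZ gtr0_norm // -/a /t mulrAC ltr_pdivrMr //.
  nra.
by have [] := fS' y u t (subset_closure Ky) (subset_closure Ku) t0 t1 St.
Qed.

Theorem theorem6 (R : realType) (X : completeNormedModType R)
    (C : set X) (K : X -> set X) (f : X -> R)
    (C_nonempty : C !=set0) (C_convex : @convex_set R X C)
    (K_map : set_valued_map C K)
    (K_compact : compact_map C K) (K_lsc : lsc_map C K)
    (K_nonempty : forall x, C x -> K x !=set0)
    (K_classD : forall x, C x -> classD (K x))
    (fixK_closed : closed (fixed_points C K))
    (f_continuous : {within C, continuous f})
    (f_quasiconvex : quasiconvex C f) :
  exists x : X, [/\ C x, K x x & forall y, K x y -> f x <= f y].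
Proof.
have [Q [cQ QC KQ']] := K_compact.
have KQ x : C x -> K x `<=` Q by move=> Cx z Kz; apply: KQ'; exists x.
have closedQ : closed Q by apply: compact_closed => //; apply: norm_hausdorff.
have fC := (@within_continuousP R X R^o C f).1 f_continuous.
apply: contrapT => nosol.
have improve x : fixed_points C K x -> exists2 y, K x y & f y < f x.
  move=> [Cx Kx]; apply: contrapT => H; apply: nosol; exists x; split=> // y Ky.
  by rewrite leNgt; apply/negP => lt; apply: H; exists y.
have [eps eps0 epsP] := uniform_improvement cQ QC KQ K_lsc fixK_closed fC improve.
pose O := improving C K f eps.
have oO : open_constraint C Q O := improving_open QC fixK_closed fC (eps := eps).
have aK : admissible C Q K.
  by split=> // [|x Cx]; [exact: lsc_map_norm|have [] := K_classD x Cx].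
have G0 x : C x -> K x `&` O x !=set0.
  move=> Cx; have [Fx|nFx] := pselect (fixed_points C K x).
    by have [y Ky fy] := epsP x Fx; exists y; split=> // _; split=> //; apply: K_map Ky.
  by have [y Ky] := K_nonempty x Cx; exists y; split.
have aG : admissible C Q (fun x => K x `&` O x).
  by apply: admissible_setI => // x _; apply: improving_convex.
have [g gC gP] := face_avoiding_selection cQ C_nonempty aG.
have gK x : C x -> closure (K x) (g x).
  by move=> Cx; apply: closure_subset (gP x Cx).1 => z [].
have [x Cx gx] : exists2 x, C x & g x = x.
  apply: (schauder C_nonempty C_convex cQ QC _ gC) => x Cx.
  by apply: closedQ; apply: (closure_subset (KQ x Cx) (gK x Cx)).
have Kgx : K x (g x).
  apply: (mem_inside_point Cx (KQ x Cx) (K_classD x Cx) oO (G0 x Cx) (gK x Cx)).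
  move=> S fS clS Sg; apply: (gP x Cx).2 fS _ _ _ clS Sg.
  - by apply: convex_closure; have [] := K_classD x Cx.
  - exact: closed_closure.
  - by move=> z [Kz _]; apply: subset_closure.
(* Only now is [x] known to be fixed, so only now does membership in [O x] carry the inequality on
   [f]. *)
have Fx : fixed_points C K x by split=> //; rewrite -{2}gx.
have [d d0 hd] := fC x Cx eps eps0.
(* A point [z] of [K x] and [O x] close to [x = g x] has [f z < f x - eps], while continuity at [x]
   gives the opposite. *)
have /closure_normP/(_ d d0)[z [_ /(_ Fx)[Cz fz]] gz] := (gP x Cx).1.
have := hd z Cz; rewrite distrC -{1}gx => /(_ gz).
by rewrite ltr_norml => /andP[+ _]; move: fz; lra.
Qed.
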